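(* Let $X$ be a compact subset of $\mathbb{R}^d$ and let $\mathbf{a}^1,\mathbf{a}^2\in\mathbb{R}^d\setminus\{\mathbf{0}\}$ be fixed. The equality $$H_1(X)+H_2(X)=C(X)$$ holds if and only if $X$ contains no closed path (with respect to $\mathbf{a}^1,\mathbf{a}^2$) and there exists a positive integer $n_0$ such that the lengths of all paths in $X$ are bounded by $n_0$.
   Context: $C(X)$ is the space of real continuous functions on $X$. For $i=1,2$, $H_i(X)=\{g(\mathbf{a}^i\cdot\mathbf{x}):g\in C(\mathbb{R})\}$, considered as functions on $X$. A path with respect to the directions $\mathbf{a}^1,\mathbf{a}^2$ in $X$ is an ordered sequence $(\mathbf{p}_1,\mathbf{p}_2,\dots)$ (finite or infinite) of points of $X$ with $\mathbf{p}_i\neq\mathbf{p}_{i+1}$ for all $i$ and either $\mathbf{a}^1\cdot\mathbf{p}_1=\mathbf{a}^1\cdot\mathbf{p}_2,\ \mathbf{a}^2\cdot\mathbf{p}_2=\mathbf{a}^2\cdot\mathbf{p}_3,\ \mathbf{a}^1\cdot\mathbf{p}_3=\mathbf{a}^1\cdot\mathbf{p}_4,\dots$ or $\mathbf{a}^2\cdot\mathbf{p}_1=\mathbf{a}^2\cdot\mathbf{p}_2,\ \mathbf{a}^1\cdot\mathbf{p}_2=\mathbf{a}^1\cdot\mathbf{p}_3,\ \mathbf{a}^2\cdot\mathbf{p}_3=\mathbf{a}^2\cdot\mathbf{p}_4,\dots$. Its length is the number of its points (members of the sequence); a single point is a path of length one. A finite path $(\mathbf{p}_1,\dots,\mathbf{p}_{2n})$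 is closed if $(\mathbf{p}_1,\dots,\mathbf{p}_{2n},\mathbf{p}_1)$ is a path. *)

(* Defs.v *)
From HB Require Import structures.
From mathcomp Require Import all_boot all_order all_algebra.
From mathcomp Require Import all_classical all_reals all_analysis.
Import numFieldNormedType.Exports.
Set Implicit Arguments.
Unset Strict Implicit.
Unset Printing Implicit Defensive.
Import Order.TTheory GRing.Theory Num.Theory.
Local Open Scope classical_set_scope.
Local Open Scope ring_scope.

Definition dot (R : realType) (d : nat) (a x : 'rV[R]_d) : R :=
  \sum_(i < d) a 0 i * x 0 i.

(* A set [X] coerces to the type of its points ([set_type]), which carries the
   subspace topology; functions on [X] are functions on that type. *)
Definition CX (R : realType) (d : nat) (X : set 'rV[R]_d) : set (X -> R) :=
  [set f : X -> R | continuous f].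
Arguments CX {R d} X.

Definition ridge (R : realType) (d : nat) (X : set 'rV[R]_d) (a : 'rV[R]_d) :
    set (X -> R) :=
  [set (fun x : X => g (dot a (val x))) | g in [set g : R -> R | continuous g]].
Arguments ridge {R d} X a.

Definition fun_set_add (R : realType) (T : Type) (F G : set (T -> R)) :
    set (T -> R) :=
  [set (fun x : T => f x + g x) | f in F & g in G].

Inductive point_seq (T : Type) : Type :=
| FinSeq of seq T
| InfSeq of (nat -> T).

(* Indices start at 0, so p_1 is the entry at 0; [None] past the end. *)
Definition entry (T : Type) (p : point_seq T) (i : nat) : option T :=
  match p with
  | FinSeq s => onth s i
  | InfSeq u => Some (u i)
  end.

Definition length_le (T : Type) (p : point_seq T) (n : nat) : Prop :=
  match p with
  | FinSeq s => (size s <= n)%N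
  | InfSeq _ => False
  end.

Definition alternates (R : realType) (d : nat) (a b : 'rV[R]_d)
    (p : point_seq 'rV[R]_d) : Prop :=
  forall (i : nat) (x y : 'rV[R]_d),
    entry p i = Some x -> entry p i.+1 = Some y ->
    if odd i then dot b x = dot b y else dot a x = dot a y.

(* The first condition excludes the empty sequence: paths have length >= 1. *)
Definition is_path (R : realType) (d : nat) (X : set 'rV[R]_d)
    (a1 a2 : 'rV[R]_d) (p : point_seq 'rV[R]_d) : Prop :=
  [/\ entry p 0 <> None,
      forall i x, entry p i = Some x -> X x,
      forall i x y, entry p i = Some x -> entry p i.+1 = Some y -> x <> y
    & alternates a1 a2 p \/ alternates a2 a1 p].

Definition is_closed_path (R : realType) (d : nat) (X : set 'rV[R]_d)
    (a1 a2 : 'rV[R]_d) (s : seq 'rV[R]_d) : Prop :=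
  match s with
  | [::] => False
  | p1 :: _ => [/\ ~~ odd (size s), is_path X a1 a2 (FinSeq s)
                 & is_path X a1 a2 (FinSeq (rcons s p1))]
  end.

(* Main.v *)
(* Write u = a1 . x and v = a2 . x.

   Sufficiency.  A bound on the lengths of paths means that, alternately deleting
   the points alone on their u-fiber and the points alone on their v-fiber, one
   exhausts X in finitely many steps.  This is used by induction to prove, without
   measures or duality, that every continuous f with |f| <= 1 on X is within any
   e > 0 of some g(u) + h(v), with a bound on g and h depending only on the number
   of steps; iterating on the error gives an exact decomposition.  For the
   inductive step, let S be the set of values of u whose fiber in X has diameter
   at least delta.  Above S the induction hypothesis applies; away from the
   corresponding set for a much smaller delta' the error r is almost constant on
   u-fibers, hence close to a function of u.  The correction can only fail on the
   zone between the two sets.  Averaging over many scales, whose zones are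
   essentially disjoint, makes the failure negligible.

   Necessity.  Long paths give sequences on which some continuous f with |f| <= 1
   takes the values 1, -1, 1, ..., whereas the alternating sums of g(u) + h(v)
   along such sequences are bounded independently of the length.  A gliding hump
   produces one continuous F with unbounded alternating sums.  A closed path
   unrolls to an infinite path, so it is excluded by the bound on lengths. *)
Require Import Defs.
From HB Require Import structures.
From mathcomp Require Import all_boot all_order all_algebra.
From mathcomp Require Import all_classical all_reals all_analysis.
From mathcomp Require Import lra ring zify.
Import numFieldNormedType.Exports.
Set Implicit Arguments.
Unset Strict Implicit.
Unset Printing Implicit Defensive.
Import Order.TTheory GRing.Theory Num.Theory.
Local Open Scope classical_set_scope.
Local Open Scope ring_scope.

(** * Compactness and separation of closed sets *)

Lemma compact_pos_lb (R : realType) (T : topologicalType) (K : set T)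
    (w : T -> R) : compact K -> continuous w -> (forall x, K x -> 0 < w x) ->
  exists2 m, 0 < m & forall x, K x -> m <= w x.
Proof.
move=> cK cw wpos; have [K0|/set0P/negP/negPn/eqP K0] := pselect (K !=set0).
  have [|c cinK cmin] := compact_EVT_min K0 cK (f := w).
    exact: continuous_subspaceT.
  exists (w c); first by apply: wpos; rewrite inE in cinK.
  by move=> x Kx; apply: cmin; rewrite inE.
by exists 1 => // x; rewrite K0.
Qed.

Lemma compact_norm_ub (R : realType) (T : topologicalType) (K : set T)
    (w : T -> R) : compact K -> {within K, continuous w} ->
  exists2 M, 0 < M & forall x, K x -> `|w x| <= M.
Proof.
move=> cK cw; have /compact_bounded [M [_ bM]] : compact (w @` K).
  exact: continuous_compact.
exists (`|M| + 1); first by rewrite ltr_wpDl.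
move=> x Kx; apply: (bM (`|M| + 1)); last by exists x.
by rewrite (le_lt_trans (ler_norm _))// ltrDl.
Qed.

Lemma closed_preimage (T U : topologicalType) (w : T -> U) (D : set U) :
  continuous w -> closed D -> closed (w @^-1` D).
Proof. by move=> cw cD; apply: preimage_closed => // x _; exact: cw. Qed.

Lemma closed_sublevel (R : realType) (T : topologicalType) (w : T -> R) (c : R) :
  continuous w -> closed [set x | w x <= c].
Proof.
move=> cw.
exact: (closed_preimage (D := [set y | y <= c]) cw (@closed_le R c)).
Qed.

Lemma closed_superlevel (R : realType) (T : topologicalType) (w : T -> R)
    (c : R) : continuous w -> closed [set x | c <= w x].
Proof.
move=> cw.
exact: (closed_preimage (D := [set y | c <= y]) cw (@closed_ge R c)).
Qed.

Lemma urysohn_metric (R : realType) (M : pseudoMetricType R) (A B : set M) :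
  closed A -> closed B -> A `&` B = set0 ->
  exists f : M -> R, [/\ continuous f, forall x, 0 <= f x <= 1,
    forall x, A x -> f x = 0 & forall x, B x -> f x = 1].
Proof.
move=> cA cB AB.
have /uniform_separatorP : uniform_separator A B.
  by have /(@normal_separatorP R) := @pseudometric_normal R M; exact.
move=> /(_ R) [f [cf f01 fA fB]]; exists f; split=> //.
- move=> x; have /f01 : range f (f x) by exists x.
  by rewrite /= in_itv.
- by move=> x Ax; apply: fA; exists x.
- by move=> x Bx; apply: fB; exists x.
Qed.

(** * Lipschitz envelopes and approximation along fibers *)

Lemma lipschitz_real_continuous (R : realType) (W : normedModType R)
    (G : W -> R) (L : R) :
  (forall s t, G s <= G t + L * `|s - t|) -> continuous G.
Proof.
move=> GL s; apply/cvgrPdist_lt => e e0.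
have L0 : 0 < `|L| + 1 by rewrite ltr_wpDl.
near=> t.
have st : `|s - t| < e / (`|L| + 1).
  by near: t; apply: cvgr_dist_lt => //; rewrite divr_gt0.
have Le : L * `|s - t| < e.
  rewrite ltr_pdivlMr // in st; apply: le_lt_trans st.
  rewrite mulrC ler_wpM2l // (le_trans (ler_norm _)) // lerDl //.
rewrite ltr_norml; have := GL s t; have := GL t s.
rewrite (distrC t s) => h1 h2; apply/andP; split; lra.
Unshelve. all: end_near. Qed.

(** The infimum inherits [L]-Lipschitz continuity from the functions under it, and [b] keeps it
    finite. The last two clauses are its defining property, so later use needs no [inf]. *)
Lemma inf_convolution (R : realType) (W : normedModType R) (T : Type)
    (A : set T) (p : T -> W) (a : T -> R) (b L : R) :
  A !=set0 -> (forall x, A x -> b <= a x) -> 0 <= L ->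
  exists2 G : W -> R, continuous G &
    (forall x s, A x -> G s <= a x + L * `|s - p x|) /\
    (forall s c, (forall x, A x -> c <= a x + L * `|s - p x|) -> c <= G s).
Proof.
move=> A0 ab L0; pose E s := [set a x + L * `|s - p x| | x in A].
have E0 s : E s !=set0 by case: A0 => x Ax; exists (a x + L * `|s - p x|), x.
have G1 x s : A x -> inf (E s) <= a x + L * `|s - p x|.
  move=> Ax; apply: ge_inf; last by exists x.
  exists b => _ [y Ay <-]; rewrite (le_trans (ab _ Ay)) // lerDl.
  by rewrite mulr_ge0.
have G2 s c : (forall x, A x -> c <= a x + L * `|s - p x|) -> c <= inf (E s).
  by move=> h; apply: lb_le_inf => // _ [y Ay <-]; exact: h.
exists (fun s => inf (E s)) => //.
apply: (@lipschitz_real_continuous _ _ _ L) => s t.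
rewrite -lerBlDr; apply: G2 => x Ax; rewrite lerBlDr.
apply: (le_trans (G1 x s Ax)); rewrite -addrA lerD2l -mulrDr ler_wpM2l //.
by rewrite [leRHS]addrC; apply: ler_distD.
Qed.

(* The witness is the inf-convolution s |-> inf_x (r x + L |s - u x|) with L
   large, clamped to [-B, B]. *)
Lemma fiberwise_approx (R : realType) (V : normedModType R) (X : set V)
    (D : set R) (r u : V -> R) (e B : R) :
  compact X -> closed D -> continuous r -> continuous u -> 0 < e -> 0 <= B ->
  (forall x, X x -> `|r x| <= B) ->
  (forall x y, X x -> X y -> u x = u y -> D (u x) -> `|r x - r y| <= e) ->
  exists g : R -> R, [/\ continuous g, forall s, `|g s| <= B &
    forall x, X x -> D (u x) -> `|r x - g (u x)| <= 2 * e].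
Proof.
move=> cX cD cr cu e0 B0 rB osc.
pose A := X `&` (u @^-1` D).
have [A0|/set0P/negP/negPn/eqP A0] := pselect (A !=set0); last first.
  exists (fun=> 0); split; first by move=> s; exact: cvg_cst.
    by move=> s; rewrite normr0.
  by move=> x Xx Dx; have : A x by []; rewrite A0.
have cA : compact A by apply: compact_closedI => //; exact: closed_preimage.
have cu1 : continuous (fun z : V * V => u z.1).
  by move=> z; apply: (continuous_comp (@cvg_fst _ _ _ _ _) (cu _)).
have cu2 : continuous (fun z : V * V => u z.2).
  by move=> z; apply: (continuous_comp (@cvg_snd _ _ _ _ _) (cu _)).
have cr1 : continuous (fun z : V * V => r z.1).
  by move=> z; apply: (continuous_comp (@cvg_fst _ _ _ _ _) (cr _)).
have cr2 : continuous (fun z : V * V => r z.2).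
  by move=> z; apply: (continuous_comp (@cvg_snd _ _ _ _ _) (cr _)).
(* Pairs over [D] on which [r] differs by too much: none share a [u]-value, so by compactness their
   [u]-values are at least some [m > 0] apart. *)
pose K := (A `*` A) `&` [set z | r z.1 - r z.2 <= - (2 * e)].
have cK : compact K.
  apply: compact_closedI; first exact: compact_setX.
  apply: (@closed_sublevel R _ (fun z : V * V => r z.1 - r z.2)) => z.
  exact: (cvgB (cr1 z) (cr2 z)).
have [m m0 mK] : exists2 m, 0 < m & forall z, K z -> m <= `|u z.1 - u z.2|.
  apply: compact_pos_lb => //.
    by move=> z; apply: cvg_norm; apply: (cvgB (cu1 z) (cu2 z)).
  move=> [x y] [[[/= Xx Dx] [Xy Dy]] rxy]; rewrite normr_gt0 subr_eq0.
  apply/eqP => uxy; have := osc x y Xx Xy uxy Dx.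
  rewrite ler_norml => /andP[h _]; lra.
(* With this slope the penalty on a pair in [K] is at least [2 * B], the largest possible variation
   of [r]. *)
pose L := 2 * B / m.
have L0 : 0 <= L by apply: divr_ge0; [exact: mulr_ge0 | exact: ltW].
have [|G cG [G1 G2]] := inf_convolution u (b := - B) A0 (a := r) _ L0.
  by move=> x [/rB + _]; rewrite ler_norml => /andP[].
exists (fun s => Num.max (- B) (Num.min B (G s))); split.
- suff : continuous ((fun=> - B) \max ((fun=> B) \min G)) by [].
  move=> s; apply: continuous_max; first exact: cvg_cst.
  by apply: continuous_min; [exact: cvg_cst | exact: cG].
- move=> s; rewrite ler_norml le_max lexx /= ge_max ge_min lexx /= andbT.
  lra.
move=> x Xx Dx; have Ax : A x by [].
have h1 := G1 x (u x) Ax; rewrite subrr normr0 mulr0 addr0 in h1.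
have h2 : r x - 2 * e <= G (u x).
  apply: G2 => y Ay; rewrite leNgt; apply/negP => hlt.
  have Ln : 0 <= L * `|u x - u y| by rewrite mulr_ge0.
  have Kyx : K (y, x) by split => //=; lra.
  have := mK _ Kyx => /= mle.
  have : 2 * B <= L * `|u x - u y|.
    have -> : 2 * B = L * m by rewrite /L divfK // gt_eqF.
    by rewrite distrC ler_wpM2l.
  have := rB x Xx; have := rB y Ay.1; rewrite !ler_norml => /andP[? ?] /andP[? ?].
  lra.
have := rB x Xx; rewrite ler_norml => /andP[rx1 rx2].
have [h3|h3] := leP (- B) (Num.min B (G (u x))).
  have [h4|h4] := leP B (G (u x)); rewrite ler_norml; apply/andP; split; lra.
move: h3; rewrite gt_min => /orP[|] h3; rewrite ler_norml; apply/andP; split; lra.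
Qed.

(** * Fibers with several points *)

Definition collisions (R : realType) (V : normedModType R) (w : V -> R)
    (X : set V) : set V :=
  X `&` [set x | exists y, [/\ X y, y <> x & w y = w x]].

(** The values taken at two distinct points of [X] form the union of these sets over [delta > 0];
    for compact [X] each is closed, while the union need not be. *)
Definition wide_fibers (R : realType) (V : normedModType R) (w : V -> R)
    (X : set V) (delta : R) : set R :=
  [set s | exists x y, [/\ X x, X y, w x = s, w y = s & delta <= `|x - y|]].

Lemma closed_wide_fibers (R : realType) (V : normedModType R) (w : V -> R)
    (X : set V) (delta : R) :
  compact X -> continuous w -> closed (wide_fibers w X delta).
Proof.
move=> cX cw.
have cw1 : continuous (fun z : V * V => w z.1).
  by move=> z; apply: (continuous_comp (@cvg_fst _ _ _ _ _) (cw _)).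
have cw2 : continuous (fun z : V * V => w z.2).
  by move=> z; apply: (continuous_comp (@cvg_snd _ _ _ _ _) (cw _)).
(* The equation [w z.1 = w z.2] is written as a sublevel condition, which is visibly closed. *)
pose K := (X `*` X) `&` [set z : V * V | `|w z.1 - w z.2| <= 0]
          `&` [set z : V * V | delta <= `|z.1 - z.2|].
have cK : compact K.
  apply: compact_closedI; last first.
    apply: (@closed_superlevel R _ (fun z : V * V => `|z.1 - z.2|)) => z.
    by apply: cvg_norm; apply: cvgB; [exact: cvg_fst | exact: cvg_snd].
  apply: compact_closedI; first exact: compact_setX.
  apply: (@closed_sublevel R _ (fun z : V * V => `|w z.1 - w z.2|)) => z.
  by apply: cvg_norm; exact: (cvgB (cw1 z) (cw2 z)).
have -> : wide_fibers w X delta = (fun z : V * V => w z.1) @` K.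
  apply/seteqP; split=> s.
    move=> [x [y [Xx Xy xs ys dxy]]]; exists (x, y) => //; split=> //; split=> //=.
    by rewrite xs ys subrr normr0.
  move=> [[x y] [[[/= Xx Xy] wxy] dxy] <-]; exists x, y; split=> //.
  by move: wxy; rewrite normr_le0 subr_eq0 => /eqP.
apply: compact_closed; first exact: norm_hausdorff.
by apply: continuous_compact => //; exact: continuous_subspaceT.
Qed.

Lemma wide_fibers_collisions (R : realType) (V : normedModType R) (w : V -> R)
    (X : set V) (delta : R) : 0 < delta ->
  X `&` (w @^-1` wide_fibers w X delta) `<=` collisions w X.
Proof.
move=> d0 x [Xx [p [q [Xp Xq wp wq dpq]]]]; split=> //.
have [px|px] := pselect (p = x); last by exists p.
exists q; split=> // qx; move: dpq; rewrite px qx subrr normr0.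
by rewrite leNgt d0.
Qed.

(** Heine-Cantor: on the compact set of pairs where [r] differs by at least [e], the distance has a
    positive lower bound. *)
Lemma uniform_modulus (R : realType) (V : normedModType R) (X : set V)
    (r : V -> R) (e : R) : compact X -> continuous r -> 0 < e ->
  exists2 m, 0 < m &
    forall x y, X x -> X y -> `|x - y| < m -> `|r x - r y| <= e.
Proof.
move=> cX cr e0.
have cr1 : continuous (fun z : V * V => r z.1).
  by move=> z; apply: (continuous_comp (@cvg_fst _ _ _ _ _) (cr _)).
have cr2 : continuous (fun z : V * V => r z.2).
  by move=> z; apply: (continuous_comp (@cvg_snd _ _ _ _ _) (cr _)).
pose K := (X `*` X) `&` [set z : V * V | e <= `|r z.1 - r z.2|].
have cK : compact K.
  apply: compact_closedI; first exact: compact_setX.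
  apply: (@closed_superlevel R _ (fun z : V * V => `|r z.1 - r z.2|)) => z.
  by apply: cvg_norm; exact: (cvgB (cr1 z) (cr2 z)).
have [| |m m0 mK] := compact_pos_lb cK (w := fun z : V * V => `|z.1 - z.2|).
- by move=> z; apply: cvg_norm; apply: cvgB; [exact: cvg_fst | exact: cvg_snd].
- move=> [x y] [_ /= exy]; rewrite normr_gt0 subr_eq0; apply/eqP => xy.
  by move: exy; rewrite xy subrr normr0 leNgt e0.
exists m => // x y Xx Xy xym; rewrite leNgt; apply/negP => exy.
have := mK (x, y); rewrite leNgt /= xym => /(_ (conj (conj Xx Xy) (ltW exy))).
by [].
Qed.

(** * Uniform approximation by sums [g (u x) + h (v x)] *)

(** The bound [C] is kept apart from [e]: it will not depend on [f] or [e], which is what lets the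
    iteration on the error converge. *)
Definition approximable (R : realType) (V : Type) (u v : V -> R) (X : set V)
    (C : R) (f : V -> R) (e : R) : Prop :=
  exists g h : R -> R, [/\ continuous g, continuous h,
    (forall s, `|g s| <= C), (forall s, `|h s| <= C) &
    forall x, X x -> `|f x - g (u x) - h (v x)| <= e].

(* The error term [2B (1 - phi)] telescopes: passing from one layer to the next
   costs at most [2B (phi1 - phi)] where the new correction is not accurate, so
   that after dividing by N the total error is O(e + 1/N). *)
Lemma layered_approx (R : realType) (V : normedModType R) (X : set V)
    (u v f : V -> R) (C e : R) :
  compact X -> continuous u -> continuous v -> continuous f ->
  0 <= C -> 0 < e -> (forall x, X x -> `|f x| <= 1) ->
  (forall Y, compact Y -> Y `<=` collisions u X -> approximable u v Y C f e) ->
  let B := 1 + 2 * C in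
  forall (N : nat) (delta : R), 0 < delta ->
  exists phi g h : R -> R,
    [/\ continuous phi, (forall s, 0 <= phi s <= 1) &
        forall s, wide_fibers u X delta s -> phi s = 1] /\
    [/\ continuous g, continuous h, (forall s, `|g s| <= N%:R * (C + B)),
        (forall s, `|h s| <= N%:R * C) &
        forall x, X x -> `|N%:R * f x - g (u x) - h (v x)| <=
          N%:R * (4 * e + 2 * B * e) + 2 * B * (1 - phi (u x))].
Proof.
move=> cX cu cv cf C0 e0 f1 core B.
have B0 : 0 <= B by rewrite /B; lra.
elim=> [|N IH] delta d0.
  exists (fun=> 1), (fun=> 0), (fun=> 0); split; split=> //.
  - by move=> s; exact: cvg_cst.
  - by move=> s; rewrite ler01 lexx.
  - by move=> s; exact: cvg_cst.
  - by move=> s; exact: cvg_cst.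
  - by move=> s; rewrite normr0 mul0r.
  - by move=> s; rewrite normr0 mul0r.
  - by move=> x _; rewrite !mul0r !subr0 normr0 subrr mulr0 addr0.
have cW : closed (wide_fibers u X delta) by exact: closed_wide_fibers.
pose Y := X `&` (u @^-1` wide_fibers u X delta).
have cY : compact Y by apply: compact_closedI => //; exact: closed_preimage.
have [g0 [h0 [cg0 ch0 g0C h0C gh0]]] := core Y cY (wide_fibers_collisions d0).
pose r x := f x - g0 (u x) - h0 (v x).
have cg0u : continuous (fun x => g0 (u x)).
  by move=> x; apply: (continuous_comp (cu x) (cg0 _)).
have ch0v : continuous (fun x => h0 (v x)).
  by move=> x; apply: (continuous_comp (cv x) (ch0 _)).
have cr : continuous r.
  by move=> x; apply: cvgB; [apply: cvgB; [exact: cf | exact: cg0u]|exact: ch0v].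
have rB x : X x -> `|r x| <= B.
  move=> Xx; have := f1 x Xx; have := g0C (u x); have := h0C (v x).
  rewrite /r /B !ler_norml => /andP[? ?] /andP[? ?] /andP[? ?].
  by apply/andP; split; lra.
(* The earlier layers use the scale [Num.min delta m]: over values that are not wide at this scale,
   [r] varies by at most [e] along the [u]-fiber. *)
have [m m0 mr] := uniform_modulus cX cr e0.
have [|phi1 [g1 [h1 [[cphi1 phi1b phi1W] [cg1 ch1 g1b h1b gh1]]]]] :=
  IH (Num.min delta m); first by rewrite lt_min d0.
(* [Z] holds the values above which the error is still large somewhere. It misses the wide fibers,
   where the error is at most [e], so a Urysohn function [phi0] can make [phi0 * r] small on all of
   [X]. *)
pose Z := u @` (X `&` [set x | 2 * e <= `|r x|]).
have cZ : closed Z.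
  apply: compact_closed; first exact: norm_hausdorff.
  apply: continuous_compact; first exact: continuous_subspaceT.
  apply: compact_closedI => //.
  apply: (@closed_superlevel R _ (fun x => `|r x|)) => x.
  by apply: cvg_norm; exact: cr.
have ZW : Z `&` wide_fibers u X delta = set0.
  apply/seteqP; split=> // s [[x [Xx /= rx] <-] Wx].
  by have := gh0 x (conj Xx Wx); rewrite -/(r x); lra.
have [phi0 [cphi0 phi0b phi0Z phi0W]] := urysohn_metric cZ cW ZW.
(* Since [phi1] is 1 on wide fibers, [phi1 s <= 1 - e] is a closed condition that excludes them. *)
have [|x y Xx Xy uxy phi1D|gc [cgc gcB gcr]] :=
    @fiberwise_approx R V X [set s | phi1 s <= 1 - e] r u e B cX _ cr cu e0 B0 rB.
- exact: closed_sublevel.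
- apply: mr => //; rewrite ltNge; apply/negP => mxy.
  have phi1x : phi1 (u x) = 1.
    by apply: phi1W; exists x, y; split=> //; rewrite ge_min mxy orbT.
  by move: phi1D => /=; lra.
pose phi s := phi0 s * phi1 s.
have cphi : continuous phi.
  by move=> s; apply: cvgM; [exact: cphi0 | exact: cphi1].
have phib s : 0 <= phi s <= 1.
  have /andP[? ?] := phi0b s; have /andP[? ?] := phi1b s.
  by rewrite /phi mulr_ge0 //= mulr_ile1.
exists phi, (fun s => g1 s + g0 s + (1 - phi s) * gc s), (fun s => h1 s + h0 s).
split; split=> //.
- move=> s Ws; rewrite /phi phi0W // phi1W ?mulr1 //.
  case: Ws => x [y [Xx Xy xs ys dxy]]; exists x, y; split=> //.
  by rewrite ge_min dxy.
- move=> s; apply: cvgD; first by apply: cvgD; [exact: cg1 | exact: cg0].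
  apply: cvgM; last exact: cgc.
  by apply: cvgB; [exact: cvg_cst | exact: cphi].
- by move=> s; apply: cvgD; [exact: ch1 | exact: ch0].
- move=> s; rewrite -natr1 (mulrDl N%:R 1) mul1r addrA.
  apply: (le_trans (ler_normD _ _)); apply: lerD; last first.
    rewrite normrM -[leRHS]mul1r; have /andP[? ?] := phib s.
    by apply: ler_pM => //; rewrite ler_norml; apply/andP; split; lra.
  by apply: (le_trans (ler_normD _ _)); apply: lerD.
- move=> s; rewrite -natr1 (mulrDl N%:R 1) mul1r.
  by apply: (le_trans (ler_normD _ _)); apply: lerD.
move=> x Xx.
(* The new error [r - (1 - phi) * gc] is split as [phi * r + (1 - phi) * (r - gc)]. *)
have -> : N.+1%:R * f x - (g1 (u x) + g0 (u x) + (1 - phi (u x)) * gc (u x)) -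
    (h1 (v x) + h0 (v x)) = (N%:R * f x - g1 (u x) - h1 (v x)) +
    (phi0 (u x) * r x) * phi1 (u x) + (1 - phi (u x)) * (r x - gc (u x)).
  by rewrite -natr1 /phi /r; ring.
have /andP[a0 a1] := phi0b (u x); have /andP[b0 b1] := phi1b (u x).
have ar : `|phi0 (u x) * r x * phi1 (u x)| <= 2 * e.
  rewrite normrM (ger0_norm b0) -[leRHS]mulr1 ler_pM //.
  have [h|h] := leP (2 * e) `|r x|.
    rewrite phi0Z ?mul0r ?normr0; first by lra.
    by exists x.
  by rewrite normrM (ger0_norm a0) -[leRHS]mul1r ler_pM // ltW.
have /andP[p0 p1] := phib (u x).
have pb : phi (u x) <= phi1 (u x) by rewrite /phi ler_piMl.
have rg : `|(1 - phi (u x)) * (r x - gc (u x))| <=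
    2 * e + 2 * B * e + 2 * B * (phi1 (u x) - phi (u x)).
  rewrite normrM ger0_norm; last lra.
  have k1 : 0 <= 2 * B * (phi1 (u x) - phi (u x)) by rewrite mulr_ge0 //; lra.
  have k2 : 0 <= 2 * B * e by rewrite mulr_ge0 //; lra.
  (* In the second case [gc] may be inaccurate, but [1 - phi] is below [phi1 - phi + e], which
     yields the telescoping term. *)
  have [h|h] := leP (phi1 (u x)) (1 - e).
    apply: (@le_trans _ _ (1 * (2 * e))); last lra.
    by apply: ler_pM => //; [lra|lra|exact: gcr].
  apply: (@le_trans _ _ ((phi1 (u x) - phi (u x) + e) * (2 * B))); last lra.
  apply: ler_pM => //; [lra|lra|].
  rewrite (le_trans (ler_normB _ _)) //.
  by have := rB x Xx; have := gcB (u x); lra.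
have := gh1 x Xx => ih.
rewrite (le_trans (ler_normD _ _)) // (le_trans (lerD (ler_normD _ _) (lexx _))) //.
rewrite -natr1 (mulrDl N%:R 1); lra.
Qed.

Lemma small_pow3 (R : realType) (b e : R) : 0 < e ->
  exists n : nat, b * 3^-1 ^+ n < e.
Proof.
move=> e0; pose n := Num.bound `|b / e|.
have bn : b / e < n%:R.
  by rewrite (le_lt_trans (ler_norm _)) // archi_boundP.
exists n; rewrite exprVn ltr_pdivrMr ?exprn_gt0 // mulrC -ltr_pdivrMr //.
by apply: (lt_le_trans bn); rewrite -natrX ler_nat ltnW // ltn_expl.
Qed.

(** Weierstrass test without limits: with [b n] the bound on the tail, [S n - b n] increases and
    [S n + b n] decreases, so the supremum of the former is the sum. *)
Lemma geometric_sum_continuous (R : realType) (T : topologicalType)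
    (G : nat -> T -> R) (C : R) :
  0 <= C -> (forall j, continuous (G j)) -> (forall j s, `|G j s| <= C) ->
  exists2 F : T -> R, continuous F &
    forall n s, `|F s - \sum_(j < n) 3^-1 ^+ j * G j s| <=
      3 / 2 * C * 3^-1 ^+ n.
Proof.
move=> C0 cG GC.
pose S n s := \sum_(j < n) 3^-1 ^+ j * G j s.
pose b n := 3 / 2 * C * 3^-1 ^+ n.
have SS n s : S n.+1 s = S n s + 3^-1 ^+ n * G n s.
  by rewrite /S big_ord_recr.
have bS n : b n.+1 = b n - C * 3^-1 ^+ n.
  by rewrite /b exprS; lra.
have step n s : `|S n.+1 s - S n s| <= b n - b n.+1.
  rewrite SS addrAC subrr add0r bS opprB addrC subrK normrM mulrC.
  rewrite (@ger0_norm _ (3^-1 ^+ n)) ?exprn_ge0 //.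
  by apply: ler_pM => //; rewrite exprn_ge0.
have Lm n k s : S n s - b n <= S (n + k)%N s - b (n + k)%N.
  elim: k => [|k IH]; first by rewrite addn0.
  rewrite addnS; have := step (n + k)%N s; rewrite ler_norml => /andP[? ?]; lra.
have Um n k s : S (n + k)%N s + b (n + k)%N <= S n s + b n.
  elim: k => [|k IH]; first by rewrite addn0.
  rewrite addnS; have := step (n + k)%N s; rewrite ler_norml => /andP[? ?]; lra.
have b0 n : 0 <= b n by rewrite /b !mulr_ge0 // exprn_ge0.
have LU n m s : S n s - b n <= S m s + b m.
  apply: (le_trans (Lm n m s)); rewrite addnC; apply: le_trans (Um m n s).
  have := b0 (m + n)%N; lra.
pose F s := sup (range (fun n => S n s - b n)).
have FS n s : `|F s - S n s| <= b n.
  have h1 : S n s - b n <= F s.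
    apply: ub_le_sup; last by exists n.
    by exists (S 0%N s + b 0%N) => _ [m _ <-]; exact: LU.
  have h2 : F s <= S n s + b n.
    apply: ge_sup; first by exists (S 0%N s - b 0%N), 0%N.
    by move=> _ [m _ <-]; exact: LU.
  by rewrite ler_norml; apply/andP; split; lra.
exists F => // s; apply/cvgrPdist_lt => e e0.
have e3 : 0 < e / 3 by rewrite divr_gt0.
have [n bn] := small_pow3 (3 / 2 * C) e3.
have cS : continuous (S n).
  elim: n {bn} => [|n IH].
    have -> : S 0%N = (fun=> 0) by apply/funext => t; rewrite /S big_ord0.
    by move=> t; exact: cvg_cst.
  have -> : S n.+1 = (fun t => S n t + 3^-1 ^+ n * G n t).
    by apply/funext => t; exact: SS.
  move=> t; apply: cvgD; first exact: IH.
  by apply: cvgM; [exact: cvg_cst | exact: cG].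
near=> t.
have : `|S n s - S n t| < e / 3.
  by near: t; move/cvgrPdist_lt : (cS s); exact.
have := FS n s; have := FS n t; rewrite -/(b n) in bn.
rewrite !ler_norml !ltr_norml => /andP[? ?] /andP[? ?] /andP[? ?].
by apply/andP; split; lra.
Unshelve. all: end_near. Qed.

(** Dividing the [N]-layer approximation by [N] makes the bounds on [g] and [h] independent of [N]
    and the telescoped error of order [1 / N]. *)
Lemma approx_of_collisions (R : realType) (V : normedModType R) (X : set V)
    (u v : V -> R) (C : R) :
  compact X -> continuous u -> continuous v -> 0 <= C ->
  (forall Y f e, compact Y -> Y `<=` collisions u X -> continuous f -> 0 < e ->
    (forall x, Y x -> `|f x| <= 1) -> approximable u v Y C f e) ->
  forall f e, continuous f -> 0 < e -> (forall x, X x -> `|f x| <= 1) ->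
  approximable u v X (C + (1 + 2 * C)) f e.
Proof.
move=> cX cu cv C0 core f e cf e0 f1.
pose B := 1 + 2 * C; have B0 : 0 < B by rewrite /B; lra.
(* Chosen so that [4 * e' + 2 * B * e'] equals [e / 2]; the choice of [N] then brings [2 * B / N]
   under [e / 2] as well. *)
pose e' := e / (8 + 4 * B).
have d0 : 0 < 8 + 4 * B by lra.
have e'0 : 0 < e' by rewrite divr_gt0.
have e'E : 8 * e' + 4 * (B * e') = e.
  by rewrite mulrA -mulrDl mulrC divfK // gt_eqF.
have core' Y : compact Y -> Y `<=` collisions u X -> approximable u v Y C f e'.
  by move=> cY YX; apply: core => // x /YX [Xx _]; exact: f1.
pose N := (Num.bound `|4 * B / e|).+1.
have N0 : 0 < N%:R :> R by rewrite ltr0n.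
have NB : 4 * B <= N%:R * e.
  rewrite -ler_pdivrMr // ltW // (le_lt_trans (ler_norm _)) //.
  by rewrite (lt_le_trans (archi_boundP _)) // ler_nat leqnSn.
have [phi [g [h [[_ phib _] [cg ch gb hb]]]]] :=
  layered_approx cX cu cv cf C0 e'0 f1 core' N ltr01.
rewrite -/B => gh.
have div_bound (a K : R) : `|a| <= N%:R * K -> `|N%:R^-1 * a| <= K.
  move=> aK; rewrite normrM gtr0_norm ?invr_gt0 // mulrC ler_pdivrMr //.
  by rewrite mulrC.
exists (fun s => N%:R^-1 * g s), (fun s => N%:R^-1 * h s); split.
- by move=> s; apply: cvgM; [exact: cvg_cst | exact: cg].
- by move=> s; apply: cvgM; [exact: cvg_cst | exact: ch].
- by move=> s; exact: div_bound.
- move=> s; apply: div_bound; apply: (le_trans (hb s)).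
  by rewrite ler_wpM2l ?ltW //; lra.
move=> x Xx.
have -> : f x - N%:R^-1 * g (u x) - N%:R^-1 * h (v x) =
    N%:R^-1 * (N%:R * f x - g (u x) - h (v x)).
  by rewrite !mulrBr mulKf // gt_eqF.
apply: div_bound; apply: (le_trans (gh x Xx)).
have /andP[p0 p1] := phib (u x).
have k1 : 2 * B * (1 - phi (u x)) <= 2 * B.
  by rewrite -[leRHS]mulr1 ler_wpM2l //; lra.
have k2 : N%:R * (4 * e' + 2 * B * e') = N%:R * e / 2.
  by rewrite -e'E; field.
lra.
Qed.

(** * Iterated deletion and exact decomposition *)

(** Swapping [u] and [v] in the recursive call makes the deletions alternate between the two
    families of fibers. *)
Fixpoint trimmed (R : realType) (V : normedModType R) (n : nat) (u v : V -> R)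
    (X : set V) : set V :=
  if n is m.+1 then trimmed m v u (collisions u X) else X.

Lemma trimmedS (R : realType) (V : normedModType R) (n : nat) (u v : V -> R)
    (X Y : set V) : X `<=` Y -> trimmed n u v X `<=` trimmed n u v Y.
Proof.
elim: n u v X Y => [//|n IH] u v X Y XY /=; apply: IH => x [Xx [y [Xy yx wyx]]].
by split; [exact: XY | exists y; split=> //; exact: XY].
Qed.

Lemma approximableC (R : realType) (V : Type) (u v : V -> R) (X : set V)
    (C : R) (f : V -> R) (e : R) :
  approximable u v X C f e -> approximable v u X C f e.
Proof.
move=> [g [h [cg ch gC hC gh]]]; exists h, g; split=> // x Xx.
by rewrite addrAC; exact: gh.
Qed.

(** Induction on the number of deletions, with [C] fixed before [X] and [f]. The collision set need
    not be compact, so the induction hypothesis is applied to compact subsets of it, with [u] and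
    [v] exchanged. *)
Lemma approx_of_trimmed (R : realType) (V : normedModType R) (n : nat) :
  exists2 C : R, 0 <= C & forall (u v : V -> R) (X : set V),
    continuous u -> continuous v -> compact X -> trimmed n u v X = set0 ->
    forall f e, continuous f -> 0 < e -> (forall x, X x -> `|f x| <= 1) ->
    approximable u v X C f e.
Proof.
elim: n => [|n [C C0 IH]].
  exists 0 => // u v X cu cv cX /= -> f e cf e0 f1.
  by exists (fun=> 0), (fun=> 0); split=> // [s|s|s|s];
    rewrite ?normr0 //; exact: cvg_cst.
exists (C + (1 + 2 * C)); first lra.
move=> u v X cu cv cX X0; apply: approx_of_collisions => //.
move=> Y f e cY YX cf e0 f1; apply: approximableC; apply: IH => //.
apply/seteqP; split=> // x /(trimmedS YX).
by rewrite -[trimmed _ _ _ _]/(trimmed n.+1 u v X) X0.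
Qed.

(** Approximate within 1/3, multiply the error by 3 to return to the unit ball, and repeat; the
    corrections sum as geometric series. *)
Lemma decompose_of_approx (R : realType) (V : normedModType R) (X : set V)
    (u v : V -> R) (C : R) :
  continuous u -> continuous v -> compact X -> 0 <= C ->
  (forall f e, continuous f -> 0 < e -> (forall x, X x -> `|f x| <= 1) ->
    approximable u v X C f e) ->
  forall f, continuous f -> exists g h : R -> R,
    [/\ continuous g, continuous h & forall x, X x -> f x = g (u x) + h (v x)].
Proof.
move=> cu cv cX C0 app f cf.
pose good (f : V -> R) := continuous f /\ forall x, X x -> `|f x| <= 1.
have third0 : 0 < 3^-1 :> R by rewrite invr_gt0.
(* Outside [good] the pair of zero functions is a mere default, making the choice total. *)
have /choice [S SP] : forall f : V -> R, exists gh : (R -> R) * (R -> R), good f ->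
    [/\ continuous gh.1, continuous gh.2, forall s, `|gh.1 s| <= C,
     forall s, `|gh.2 s| <= C &
     forall x, X x -> `|f x - gh.1 (u x) - gh.2 (v x)| <= 3^-1].
  move=> k; have [[ck k1]|nk] := pselect (good k); last by exists (fun=> 0, fun=> 0).
  by have [g [h ?]] := app k 3^-1 ck third0 k1; exists (g, h).
have [M M0 fM] := compact_norm_ub cX (continuous_subspaceT cf).
pose F := fix F n x := if n is m.+1 then
  3 * (F m x - (S (F m)).1 (u x) - (S (F m)).2 (v x)) else f x / M.
have gF n : good (F n).
  elim: n => [|n IH].
    split; first by move=> x; apply: cvgM; [exact: cf | exact: cvg_cst].
    by move=> x Xx; rewrite /F normrM normfV (gtr0_norm M0) ler_pdivrMr ?mul1r //;
      exact: fM.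
  have [cg ch _ _ gh] := SP _ IH; split.
    move=> x; apply: cvgM; first exact: cvg_cst.
    apply: cvgB; first (apply: cvgB; first exact: IH.1).
      exact: (continuous_comp (cu x) (cg _)).
    exact: (continuous_comp (cv x) (ch _)).
  move=> x Xx; rewrite [F _ _]/= normrM ger0_norm //.
  by have := gh x Xx; lra.
pose Ge n := (S (F n)).1; pose He n := (S (F n)).2.
have [|n s|g cg gS] := @geometric_sum_continuous _ _ Ge C C0.
- by move=> n; have [] := SP _ (gF n).
- by have [_ _ + _ _] := SP _ (gF n); apply.
have [|n s|h ch hS] := @geometric_sum_continuous _ _ He C C0.
- by move=> n; have [] := SP _ (gF n).
- by have [_ _ _ + _] := SP _ (gF n); apply.
have FE n x : f x / M = \sum_(j < n) 3^-1 ^+ j * Ge j (u x) +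
    \sum_(j < n) 3^-1 ^+ j * He j (v x) + 3^-1 ^+ n * F n x.
  elim: n => [|n IH]; first by rewrite !big_ord0 expr0 !add0r mul1r.
  rewrite IH.
  by rewrite !big_ord_recr /= exprS /Ge /He; field.
exists (fun s => M * g s), (fun s => M * h s); split.
- by move=> s; apply: cvgM; [exact: cvg_cst | exact: cg].
- by move=> s; apply: cvgM; [exact: cvg_cst | exact: ch].
move=> x Xx.
suff E : f x / M = g (u x) + h (v x).
  by rewrite -mulrDr -E mulrC divfK // gt_eqF.
apply/eqP; rewrite -subr_eq0 -normr_le0 leNgt; apply/negP => e0.
(* Two tails of [3 / 2 * C] and a remainder bounded by 1, all scaled by [3^-1 ^+ n]. *)
have [n] := small_pow3 (3 * C + 1) e0; apply/negP; rewrite -leNgt.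
have hF : `|3^-1 ^+ n * F n x| <= 3^-1 ^+ n.
  rewrite normrM ger0_norm ?exprn_ge0 // -[leRHS]mulr1 ler_wpM2l ?exprn_ge0 //.
  exact: (gF n).2.
have := gS n (u x); have := hS n (v x); move: hF; rewrite (FE n x).
rewrite !ler_norml => /andP[? ?] /andP[? ?] /andP[? ?].
by apply/andP; split; lra.
Qed.

(** * Walks and alternating sums *)

Definition walk (R : realType) (V : Type) (u v : V -> R) (X : set V) (K : nat)
    (q : nat -> V) : Prop :=
  (forall i, (i < K)%N -> X (q i)) /\
  (forall i, (i.+1 < K)%N ->
    (if odd i then v else u) (q i) = (if odd i then v else u) (q i.+1)).

(** Exactly what makes the prescription [f (q k) = (-1) ^+ k] for [k < K] well defined. *)
Definition parity_consistent (V : Type) (K : nat) (q : nat -> V) : Prop :=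
  forall i j, (i < K)%N -> (j < K)%N -> q i = q j -> odd i = odd j.

(* A shortest violation q i = q (i + d) with d odd closes up: the points strictly
   between form a cycle of even length d - 1, which is then repeated. *)
Lemma walk_parity_consistent (R : realType) (V : Type) (u v : V -> R)
    (X : set V) (K : nat) (q : nat -> V) :
  walk u v X K q -> (forall i, (i.+1 < K)%N -> q i <> q i.+1) ->
  exists q', (walk u v X K q' \/ walk v u X K q') /\ parity_consistent K q'.
Proof.
move=> [qX qs] qne.
have [good|bad] := pselect (parity_consistent K q).
  by exists q; split=> //; left.
pose P d := `[< exists i, [/\ (i + d < K)%N, odd d & q i = q (i + d)%N] >].
have exP : exists d, P d.
  apply: contrapT => nP; apply: bad => i j iK jK qij.
  have odd_eq k l : (l < K)%N -> (k <= l)%N -> q k = q l -> odd k = odd l.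
    move=> lK kl qkl; apply: contrapT => /eqP okl; apply: nP.
    exists (l - k)%N; apply/asboolP; exists k; rewrite subnKC //; split=> //.
    by rewrite oddB //; move: okl; case: (odd k); case: (odd l).
  by have [ij|/ltnW ji] := leqP i j; [|apply/esym]; exact: odd_eq.
case: (ex_minnP exP) => d /asboolP [i [idK od qid]] dmin.
have d2 : (2 < d)%N.
  case: d od idK qid {dmin} => [|[|[|d]]] //= _; rewrite addn1 => idK /qne.
  by move=> /(_ idK).
pose M := d.-1.
have dM : d = M.+1 by rewrite /M prednK // (ltn_trans _ d2).
have oM : odd M = false by move: od; rewrite dM /=; case: odd.
have M0 : (0 < M)%N by rewrite /M -subn1 subn_gt0 (ltn_trans _ d2).
pose q' k := q (i.+1 + k %% M)%N.
have oddm k : odd (k %% M)%N = odd k by rewrite odd_mod.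
have kM k : (i.+1 + k %% M < i + d)%N by rewrite dM addSnnS ltn_add2l ltnS ltn_pmod.
exists q'; split; last first.
  have odd_eq k l : (k %% M < l %% M)%N -> q' k = q' l -> odd k = odd l.
    move=> kl qkl; apply: contrapT => /eqP okl; have kl' := ltnW kl.
    (* A clash inside the cycle would be a violation at an odd distance smaller than [d]. *)
    have : P (l %% M - k %% M)%N.
      apply/asboolP; exists (i.+1 + k %% M)%N; rewrite -addnA subnKC //.
      split=> //; first exact: ltn_trans (kM l) idK.
      by rewrite oddB // !oddm; move: okl; case: (odd k); case: (odd l).
    move/dmin; rewrite leqNgt => /negP; apply.
    by rewrite (leq_ltn_trans (leq_subr _ _)) // dM ltnS ltnW // ltn_pmod.
  move=> k l kK lK qkl; have [kl|lk|kl] := ltngtP (k %% M) (l %% M).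
  - exact: odd_eq.
  - exact/esym/odd_eq.
  - by rewrite -(oddm k) kl oddm.
(* The cycle starts at [i.+1], so its first two points share [v] when [i] is even and [u] when [i]
   is odd. *)
have w' : walk (if odd i then u else v) (if odd i then v else u) X K q'.
  split=> [k kK|k kK]; first by apply: qX; exact: ltn_trans (kM k) idK.
  have -> : (if odd k then if odd i then v else u else if odd i then u else v) =
      (if odd (i.+1 + k %% M) then v else u).
    by rewrite oddD oddm /=; case: (odd k); case: (odd i).
  have [km|km] := ltnP (k %% M).+1 M.
    have kS : (k.+1 %% M = (k %% M).+1)%N.
      by rewrite -addn1 -modnDml addn1 modn_small.
    rewrite /q' kS addnS; apply: qs.
    by move: (kM k.+1); rewrite kS addnS => /ltn_trans; apply.
  have {}km : (k %% M).+1 = M by apply/eqP; rewrite eqn_leq km ltn_pmod.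
  (* Wrap-around: the last point of the cycle is joined to [q (i + d)], that is [q i], by the
     coordinate that joins [q i] to [q i.+1], because [d - 1] is even. *)
  have kS : (k.+1 %% M = 0)%N by rewrite -addn1 -modnDml addn1 km modnn.
  rewrite /q' kS addn0.
  have kd : (i.+1 + k %% M).+1 = (i + d)%N by rewrite dM -[in RHS]km; lia.
  have od' : odd (i.+1 + k %% M) = odd i.
    by have := congr1 odd kd; rewrite /= !oddD od /=; lia.
  rewrite qs ?kd // -qid od'; apply: qs.
  by rewrite (leq_ltn_trans _ idK) // -addn1 leq_add2l ltnW // ltnW.
by case: (odd i) w' => ?; [left | right].
Qed.

Lemma alternating_sum_pairs (R : realType) (c : nat -> R) (K : nat) :
  (forall i, ~~ odd i -> (i.+1 < K)%N -> c i = c i.+1) ->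
  forall n, (n <= K)%N ->
  \sum_(k < n) (-1) ^+ k * c k = if odd n then c n.-1 else 0.
Proof.
move=> cc; elim=> [|n IH] nK; first exact: big_ord0.
rewrite big_ord_recr /= (IH (ltnW nK)) -signr_odd.
case: (boolP (odd n)) => on /=; last by rewrite expr0 mul1r add0r.
case: n on nK {IH} => [//|n] /= on nK.
by rewrite expr1 mulN1r -(cc n on nK) subrr.
Qed.

(** The [g] terms cancel in pairs from index 0, leaving at most the last one; the [h] terms cancel
    in pairs from index 1, leaving at most the first and the last. *)
Lemma walk_sum_bound (R : realType) (V : Type) (u v : V -> R) (X : set V)
    (K : nat) (q : nat -> V) (g h : R -> R) (C : R) :
  0 <= C -> (forall x, X x -> `|g (u x)| <= C) ->
  (forall x, X x -> `|h (v x)| <= C) -> walk u v X K q ->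
  `|\sum_(k < K) (-1) ^+ k * (g (u (q k)) + h (v (q k)))| <= 3 * C.
Proof.
move=> C0 gC hC [qX qs].
have -> : \sum_(k < K) (-1) ^+ k * (g (u (q k)) + h (v (q k))) =
    \sum_(k < K) (-1) ^+ k * g (u (q k)) + \sum_(k < K) (-1) ^+ k * h (v (q k)).
  by rewrite -big_split /=; apply: eq_bigr => k _; rewrite mulrDr.
have gE : `|\sum_(k < K) (-1) ^+ k * g (u (q k))| <= C.
  rewrite (@alternating_sum_pairs _ (fun k => g (u (q k))) K) //; last first.
    by move=> i /negbTE oi iK; have := qs i iK; rewrite oi => ->.
  case: (boolP (odd K)) => oK; last by rewrite normr0.
  by apply/gC/qX; case: (K) oK.
suff hE : `|\sum_(k < K) (-1) ^+ k * h (v (q k))| <= 2 * C.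
  by rewrite (le_trans (ler_normD _ _)) //; lra.
case: K qX qs {gE} => [|n] qX qs; first by rewrite big_ord0 normr0 mulr_ge0.
have -> : \sum_(k < n.+1) (-1) ^+ k * h (v (q k)) =
    h (v (q 0%N)) - \sum_(k < n) (-1) ^+ k * h (v (q k.+1)).
  rewrite big_ord_recl expr0 mul1r -sumrN; congr (_ + _).
  by apply: eq_bigr => k _; rewrite exprS mulN1r mulNr.
rewrite (@alternating_sum_pairs _ (fun k => h (v (q k.+1))) n) //; last first.
  by move=> i oi iK; have := qs i.+1 iK; rewrite /= oi => ->.
rewrite (le_trans (ler_normB _ _)) // mulrDl mul1r lerD //; first exact/hC/qX.
case: (boolP (odd n)) => on; last by rewrite normr0.
by apply/hC/qX; case: (n) on => //= m _; rewrite ltnS.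
Qed.

(* Gliding hump, with K_j = 2 j 3^j: the sign of the j-th bump is chosen so that
   it does not cancel the preceding partial sum. *)
Lemma unbounded_alternating_sums (R : realType) (V : topologicalType)
    (q : nat -> nat -> V) (f : nat -> V -> R) :
  (forall K, continuous (f K)) -> (forall K x, `|f K x| <= 1) ->
  (forall K k, (k < K)%N -> f K (q K k) = (-1) ^+ k) ->
  exists2 F : V -> R, continuous F &
    forall M, exists K, M < `|\sum_(k < K) (-1) ^+ k * F (q K k)|.
Proof.
move=> cf f1 fq.
pose L K (F : V -> R) := \sum_(k < K) (-1) ^+ k * F (q K k).
pose N j := (2 * (j * 3 ^ j))%N.
(* The value at 0 is 1, so that no bump is annihilated. *)
pose sgn (a : R) : R := if 0 <= a then 1 else -1.
pose bump j F := fun x => sgn (L (N j) F) * f (N j) x.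
pose S := fix S j : V -> R :=
  if j is i.+1 then fun x => S i x + 3^-1 ^+ i * bump i (S i) x else fun=> 0.
have SE n x : S n x = \sum_(j < n) 3^-1 ^+ j * bump j (S j) x.
  by elim: n => [|n IH] /=; rewrite ?big_ord0 // big_ord_recr /= IH.
have sgn1 a : `|sgn a| = 1 by rewrite /sgn; case: ifP; rewrite ?normrN1 ?normr1.
have [j|j x|F cF FS] := @geometric_sum_continuous R V (fun j => bump j (S j)) 1 ler01.
- by move=> x; apply: cvgM; [exact: cvg_cst | exact: cf].
- by rewrite normrM sgn1 mul1r.
have Lbump j : L (N j) (S j.+1) = L (N j) (S j) +
    sgn (L (N j) (S j)) * (3^-1 ^+ j * (N j)%:R).
  rewrite {1}/L (eq_bigr (fun k : 'I_(N j) => (-1) ^+ k * S j (q (N j) k) +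
    sgn (L (N j) (S j)) * 3^-1 ^+ j)); last first.
    move=> k _; rewrite /= /bump fq // mulrDr; congr (_ + _).
    by rewrite -signr_odd; case: (odd k); rewrite /=; ring.
  by rewrite big_split /= sumr_const card_ord -[_ *+ N j in LHS]mulr_natr -mulrA.
have big_sum j : 3^-1 ^+ j * (N j)%:R <= `|L (N j) (S j.+1)|.
  have t0 : 0 <= 3^-1 ^+ j * (N j)%:R :> R by rewrite mulr_ge0 // exprn_ge0.
  rewrite Lbump /sgn; case: (leP 0 (L (N j) (S j))) => L0.
    by rewrite mul1r ger0_norm ?lerDr // addr_ge0.
  by rewrite mulN1r ler0_norm; lra.
(* The bumps after the [j]-th add up to at most [3^-1 ^+ j / 2] at each point, so they destroy at
   most half of the [2 * j] gained. *)
have close j : `|L (N j) F - L (N j) (S j.+1)| <= 3^-1 ^+ j * (N j)%:R / 2.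
  rewrite /L -sumrB (le_trans (ler_norm_sum _ _ _)) //.
  have -> : 3^-1 ^+ j * (N j)%:R / 2 = \sum_(k < N j) 3^-1 ^+ j / 2 :> R.
    by rewrite sumr_const card_ord -mulr_natr; ring.
  apply: ler_sum => k _; rewrite -mulrBr normrM normrX normrN1 expr1n mul1r.
  have := FS j.+1 (q (N j) k); rewrite -SE exprS; lra.
exists F => // M; exists (N (Num.bound `|M|)); set j := Num.bound _.
apply: (le_lt_trans (ler_norm _)).
have Mj : `|M| < j%:R by rewrite archi_boundP.
apply: (lt_le_trans Mj).
have NE : 3^-1 ^+ j * (N j)%:R = 2 * j%:R :> R.
  by rewrite /N !natrM natrX exprVn; field; rewrite expf_neq0.
have := big_sum j; have := close j; rewrite NE distrC -/(L (N j) F).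
by have := ler_normD (L (N j) (S j.+1) - L (N j) F) (L (N j) F); rewrite subrK; lra.
Qed.

(** The points of odd index and those of even index form disjoint finite closed sets; a Urysohn
    function between them is rescaled to [[-1, 1]]. *)
Lemma sign_interpolation (R : realType) (V : pseudoMetricType R) (K : nat)
    (q : nat -> V) : hausdorff_space V -> parity_consistent K q ->
  exists f : V -> R, [/\ continuous f, forall x, `|f x| <= 1 &
    forall k, (k < K)%N -> f (q k) = (-1) ^+ k].
Proof.
move=> hV qc.
pose P b := q @` [set k | (k < K)%N /\ odd k = b].
have cP b : closed (P b).
  apply: compact_closed => //; apply/finite_compact/finite_image.
  by apply: (sub_finite_set _ (finite_II K)) => k [].
have P0 : P true `&` P false = set0.
  apply/seteqP; split=> // _ [[k [kK ok] <-] [l [lK ol] qlk]].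
  by have := qc _ _ lK kK qlk; rewrite ok ol.
have [f [cf f01 fT fF]] := urysohn_metric (cP true) (cP false) P0.
exists (fun x => 2 * f x - 1); split.
- move=> x; apply: cvgB; last exact: cvg_cst.
  by apply: cvgM; [exact: cvg_cst | exact: cf].
- by move=> x; have := f01 x; rewrite ler_norml => /andP[? ?]; apply/andP; split; lra.
move=> k kK; rewrite -signr_odd; case ok : (odd k).
  by rewrite fT ?mulr0 ?add0r ?expr1 //; exists k.
by rewrite fF ?expr0; [lra | exists k].
Qed.

Lemma walks_not_decomposable (R : realType) (V : normedModType R) (X : set V)
    (u v : V -> R) (q : nat -> nat -> V) :
  compact X -> continuous u -> continuous v ->
  (forall K, (walk u v X K (q K) \/ walk v u X K (q K)) /\
             parity_consistent K (q K)) ->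
  exists2 F : V -> R, continuous F &
    ~ exists g h : R -> R, [/\ continuous g, continuous h &
        forall x, X x -> F x = g (u x) + h (v x)].
Proof.
move=> cX cu cv qw.
have [f fP] := choice (fun K => sign_interpolation (@norm_hausdorff _ V) (qw K).2).
have [K|K x|K k kK|F cF FM] := @unbounded_alternating_sums R V q f.
- by have [] := fP K.
- by have [_ + _] := fP K; apply.
- by have [_ _ +] := fP K; apply.
exists F => // -[g [h [cg ch FE]]].
have [Mg Mg0 gM] : exists2 M, 0 < M & forall x, X x -> `|g (u x)| <= M.
  apply: compact_norm_ub => //; apply: continuous_subspaceT => x.
  exact: (continuous_comp (cu x) (cg _)).
have [Mh Mh0 hM] : exists2 M, 0 < M & forall x, X x -> `|h (v x)| <= M.
  apply: compact_norm_ub => //; apply: continuous_subspaceT => x.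
  exact: (continuous_comp (cv x) (ch _)).
have [K] := FM (3 * (Mg + Mh)); apply/negP; rewrite -leNgt.
(* One common bound for both functions serves walks of either orientation. *)
have C0 : 0 <= Mg + Mh by lra.
have gC x : X x -> `|g (u x)| <= Mg + Mh by move=> /gM; lra.
have hC x : X x -> `|h (v x)| <= Mg + Mh by move=> /hM; lra.
have [[] wK _] := qw K.
  rewrite (eq_bigr (fun k : 'I_K => (-1) ^+ k *
    (g (u (q K k)) + h (v (q K k))))); first exact: (walk_sum_bound C0 gC hC wK).
  by move=> k _; rewrite FE //; apply: wK.1.
rewrite (eq_bigr (fun k : 'I_K => (-1) ^+ k *
  (h (v (q K k)) + g (u (q K k))))); first exact: (walk_sum_bound C0 hC gC wK).
by move=> k _; rewrite FE 1?addrC //; apply: wK.1.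
Qed.

(** * From paths to walks, and from trimmed sets to paths *)

Lemma onth_some (T : Type) (x0 : T) (s : seq T) (i : nat) :
  (i < size s)%N -> onth s i = Some (nth x0 s i).
Proof.
by rewrite -onthTE -(odflt_onth x0); case: (onth s i).
Qed.

(** Periodic repetition: the even length preserves the parity of indices, and the appended [p1]
    provides the adjacency at the seam. *)
Lemma closed_path_unroll (R : realType) (d : nat) (X : set 'rV[R]_d)
    (a1 a2 : 'rV[R]_d) (s : seq 'rV[R]_d) :
  is_closed_path X a1 a2 s -> exists q, is_path X a1 a2 (InfSeq q).
Proof.
case: s => [//|p1 t]; set s := p1 :: t => -[es _ [_ sX sne salt]].
pose q i := nth p1 s (i %% size s)%N.
have s0 : (0 < size s)%N by [].
have entry_q i : entry (FinSeq (rcons s p1)) (i %% size s)%N = Some (q i).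
  have lt := ltn_pmod i s0.
  by rewrite /entry (onth_some p1) ?size_rcons 1?ltnW // nth_rcons lt.
have entry_qS i : entry (FinSeq (rcons s p1)) (i %% size s)%N.+1 = Some (q i.+1).
  have lt := ltn_pmod i s0.
  rewrite /entry (onth_some p1) ?size_rcons ?ltnS // nth_rcons /q -(addn1 i).
  have [lt'|ge] := ltnP (i %% size s).+1 (size s).
    by rewrite -modnDml addn1 (modn_small lt').
  have E : (i %% size s).+1 = size s by apply/eqP; rewrite eqn_leq lt ge.
  by rewrite E eqxx -modnDml addn1 E modnn.
have odd_q i : odd (i %% size s)%N = odd i by rewrite odd_mod //; apply/negbTE.
exists q; split=> [//|i x /= [<-]|i x y /= [<-] [<-]|].
- exact: sX (entry_q i).
- exact: sne (entry_q i) (entry_qS i).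
by case: salt => salt; [left|right] => i x y /= [<-] [<-];
  have := salt _ _ _ (entry_q i) (entry_qS i); rewrite odd_q.
Qed.

(** The path is built backwards: the first point of a path inside [collisions (dot a) X] has a
    distinct partner in [X] on its [a]-fiber, which is prepended. *)
Lemma path_of_trimmed (R : realType) (d n : nat) (X : set 'rV[R]_d.+1)
    (a b x : 'rV[R]_d.+1) : trimmed n (dot a) (dot b) X x ->
  exists s, [/\ size s = n.+1, forall i y, onth s i = Some y -> X y,
    forall i y z, onth s i = Some y -> onth s i.+1 = Some z -> y <> z
    & alternates a b (FinSeq s)].
Proof.
elim: n a b X x => [|n IH] a b X x /=.
  move=> Xx; exists [:: x]; split=> //.
  - by move=> i y /onth1P [_ <-].
  - by move=> i y z /onth1P [-> _].
  - by move=> i y z /= /onth1P [-> _].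
move=> /IH [[|y s] [//= ssz sX sne salt]].
have [Xy [z [Xz zy azy]]] : collisions (dot a) X y by exact: (sX 0%N).
exists [:: z, y & s]; split=> /=; first by rewrite ssz.
- by case=> [|i] w /=; [case=> <- | case/sX].
- by case=> [|i] w t /=; [move=> [<-] [<-] | exact: sne].
- case=> [|i] w t /=; first by move=> [<-] [<-].
  by move=> wi ti; have := salt i w t wi ti; case: (odd i).
Qed.

Lemma walks_of_unbounded_paths (R : realType) (d : nat) (X : set 'rV[R]_d)
    (a1 a2 : 'rV[R]_d) :
  ~ (exists n0 : nat, (0 < n0)%N /\
     forall p : point_seq 'rV[R]_d, is_path X a1 a2 p -> length_le p n0) ->
  forall K, exists q, (walk (dot a1) (dot a2) X K q \/
    walk (dot a2) (dot a1) X K q) /\ parity_consistent K q.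
Proof.
move=> nb K.
have [p [[_ pX pne palt] pK]] : exists p, is_path X a1 a2 p /\ ~ length_le p K.+1.
  apply: contrapT => np; apply: nb; exists K.+1; split=> // p pp.
  by apply: contrapT => pK; apply: np; exists p.
(* The default 0 is never read below [K], since [p] has more than [K.+1] points. *)
pose q i := if p is InfSeq u then u i else odflt 0 (entry p i).
have pq i : (i < K)%N -> entry p i = Some (q i).
  move=> iK; rewrite /q; case: p {pX pne palt q} pK => [s|//] /= /negP.
  by rewrite -ltnNge => /ltnW /(ltn_trans iK) iS; rewrite (onth_some 0 iS).
have qX i : (i < K)%N -> X (q i) by move=> /pq /pX.
have qne i : (i.+1 < K)%N -> q i <> q i.+1.
  by move=> iK; exact: pne (pq i (ltnW iK)) (pq i.+1 iK).
case: palt => palt.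
  have w : walk (dot a1) (dot a2) X K q.
    split=> // i iK; have := palt _ _ _ (pq i (ltnW iK)) (pq i.+1 iK).
    by case: (odd i).
  exact: walk_parity_consistent w qne.
have w : walk (dot a2) (dot a1) X K q.
  split=> // i iK; have := palt _ _ _ (pq i (ltnW iK)) (pq i.+1 iK).
  by case: (odd i).
have [q' [[]]] := walk_parity_consistent w qne; exists q'; split=> //.
  by right.
by left.
Qed.

(** * Extension from [X] and the equivalence *)

Lemma dot_continuous (R : realType) (d : nat) (a : 'rV[R]_d) :
  continuous (dot a).
Proof.
have cadd : continuous (fun z : R * R => z.1 + z.2).
  by move=> z; apply: cvgD; [exact: cvg_fst | exact: cvg_snd].
apply: (continuous_big cadd (F := fun i (x : 'rV[R]_d) => a 0 i * x 0 i)).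
move=> i _ x; apply: continuousM; last exact: coord_continuous.
exact: cst_continuous.
Qed.

(** Tietze extension, applied to [f] prolonged by 0 outside [X], which is continuous within [X] and
    bounded there by compactness. *)
Lemma compact_extension (R : realType) (V : normedModType R) (X : set V)
    (f : X -> R) : compact X -> continuous f ->
  exists2 F : V -> R, continuous F & forall x : X, F (val x) = f x.
Proof.
move=> cX cf.
have EX : sigL X ('valL_ 0 f) = f.
  by rewrite -[LHS]/((sigL X \o 'valL_ 0) f) sigL_valL.
have wc : {within X, continuous ('valL_ 0 f)}.
  by apply/subspace_sigL_continuousP; rewrite EX.
have [M M0 fM] := compact_norm_ub cX wc.
have clX : closed X by apply: compact_closed => //; exact: norm_hausdorff.
have [F [FE cF _]] := continuous_bounded_extension
  (@pseudometric_normal R V) clX M0 wc fM.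
exists F => // x; rewrite -[in RHS]EX -FE //.
exact: (valP x).
Qed.

Theorem theorem1p7 (R : realType) (d : nat) (X : set 'rV[R]_d)
    (a1 a2 : 'rV[R]_d) (Xcompact : compact X) (a1_neq0 : a1 <> 0)
    (a2_neq0 : a2 <> 0) :
  fun_set_add (ridge X a1) (ridge X a2) = CX X <->
  (~ exists s : seq 'rV[R]_d, is_closed_path X a1 a2 s) /\
  (exists n0 : nat, (0 < n0)%N /\
     forall p : point_seq 'rV[R]_d, is_path X a1 a2 p -> length_le p n0).
Proof.
(* In dimension 0 every vector vanishes, contradicting [a1 <> 0]. *)
case: d X a1 a2 Xcompact a1_neq0 a2_neq0 => [|d] X a1 a2 cX a1_neq0 a2_neq0.
  by case: a1_neq0; apply/rowP => -[].
have cu := @dot_continuous R d.+1 a1; have cv := @dot_continuous R d.+1 a2.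
split=> [XE|[_ [n0 [_ bounded]]]].
  suff [n0 [n00 bounded]] : exists n0 : nat, (0 < n0)%N /\
      forall p : point_seq 'rV[R]_d.+1, is_path X a1 a2 p -> length_le p n0.
    split; last by exists n0.
    by move=> [s /closed_path_unroll [q /bounded]].
  apply: contrapT => /walks_of_unbounded_paths /choice [q qw].
  have [F cF] := walks_not_decomposable cX cu cv qw; apply.
  have : CX X (fun x => F (val x)).
    move=> x; apply: (continuous_comp (g := F)); last exact: cF.
    exact: initial_continuous.
  rewrite -XE => -[_ [g cg <-] [_ [h ch <-] ghF]].
  exists g, h; split=> // x Xx.
  by have := congr1 (@^~ (exist _ x (mem_set Xx))) ghF.
have [C C0 approx] := @approx_of_trimmed R 'rV[R]_d.+1 n0.
(* A point surviving [n0] deletions would give a path of [n0.+1] points. *)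
have trim0 : trimmed n0 (dot a1) (dot a2) X = set0.
  apply/seteqP; split=> // x /path_of_trimmed [s [ssz sX sne salt]].
  have /bounded : is_path X a1 a2 (FinSeq s).
    by split=> //; [case: (s) ssz | left].
  by rewrite /= ssz ltnn.
have decompose := decompose_of_approx cu cv cX C0 (approx _ _ _ cu cv cX trim0).
apply/seteqP; split=> f.
  have cridge (a : 'rV[R]_d.+1) (g : R -> R) :
      continuous g -> continuous (fun x : X => g (dot a (val x))).
    move=> cg x; apply: (@continuous_comp X 'rV[R]_d.+1 R val (g \o dot a) x).
      exact: initial_continuous.
    by apply: continuous_comp; [exact: dot_continuous | exact: cg].
  move=> [_ [g cg <-] [_ [h ch <-] <-]] x.
  exact: (continuousD (cridge a1 g cg x) (cridge a2 h ch x)).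
move=> /(compact_extension cX) [F cF FE].
have [g [h [cg ch FgH]]] := decompose F cF.
exists (fun x : X => g (dot a1 (val x))); first by exists g.
exists (fun x : X => h (dot a2 (val x))); first by exists h.
apply/funext => x; rewrite -FE FgH //; exact: set_valP.
Qed.
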